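(* Let $W$, $\widehat P_n$, $a_{n,j}$, $\gamma_n$ and $Y^n$ be as in the context. There is a unique sequence of matrix coefficients $\alpha_n\in\mathbb{C}^{N\times N}$, $n\ge0$, such that $$Y^{n+1}(z)=\begin{pmatrix} zI_N-\alpha_n&\frac1{2\pi i}\gamma_n^{-1}\\ -2\pi i\,\gamma_n&0\end{pmatrix}Y^n(z),\qquad n\ge0.$$ Consequently the monic orthogonal matrix polynomials satisfy the three-term recurrence relation $$x\widehat P_n(x)=\widehat P_{n+1}(x)+\alpha_n\widehat P_n(x)+\beta_n\widehat P_{n-1}(x),\qquad n\ge0.$$ Moreover $$\alpha_n=(Y_1^n)_{11}-(Y_1^{n+1})_{11}=a_{n,n-1}-a_{n+1,n},\qquad \beta_n=(Y_1^n)_{12}(Y_1^n)_{21}=\gamma_n^{-1}\gamma_{n-1},$$ $$\gamma_n=-\frac1{2\pi i}(Y_1^{n+1})_{21}=-\frac1{2\pi i}\big((Y_1^n)_{12}\big)^{-1}.$$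
   Context: Fix $N\ge1$ and a finite or infinite interval $(a,b)\subset\mathbb{R}$. The weight $W=(W_{ij}):(a,b)\to GL(N,\mathbb{R})$ is continuous and differentiable, $W(x)$ is (symmetric) positive definite for every $x$, and all entries of $W$ and $W'$ have finite moments of all orders. At every finite endpoint $c\in\{a,b\}$, $W(x)=|x-c|^{s_c}\widetilde W(x)$ with a scalar $s_c>-1$ and $\widetilde W$ bounded, continuous and non-vanishing at $c$. $A^*$ is the conjugate transpose; for functions of a complex variable $F^*(z):=(F(\bar z))^*$. $\widehat P_n(x)=x^nI_N+\sum_{j=0}^{n-1}a_{n,j}x^j$ is the monic matrix polynomial of degree $n$ with $\int_a^b\widehat P_n W Q^*dx=0$ for all matrix polynomials $Q$ of degree $\le n-1$; $\gamma_n=\big(\int_a^b\widehat P_nW\widehat P_n^*dx\big)^{-1}$ (equivalently $\gamma_n=\kappa_n^*\kappa_n$ where $\kappa_n\widehat P_n$ is orthonormal). Conventions: $\widehat P_{-1}=0$, $\gamma_{-1}=0$, $a_{0,-1}=0$. $\mathcal{C}(F)(z)=\frac1{2\pi i}\int_a^b\frac{F(t)}{t-z}dt$. In $N\times N$ blocks, $Y^0(z)=\begin{pmatrix}I_N&\mathcal{C}(W)(z)\\0&I_N\end{pmatrix}$ and for $n\ge1$ $$Y^n(z)=\begin{pmatrix}\widehat P_n(z)&\mathcal{C}(\widehat P_nW)(z)\\ -2\pi i\gamma_{n-1}\widehat P_{n-1}(z)&-2\pi i\gamma_{n-1}\mathcal{C}(\widehat P_{n-1}W)(z)\end{pmatrix},\quad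 z\in\mathbb{C}\setminus[a,b]$$ (the unique solution of the Riemann–Hilbert problem associated with $W$). $Y_1^n$ is the constant $2N\times2N$ matrix in $Y^n(z)=\big(I_{2N}+Y_1^n/z+\mathcal{O}(1/z^2)\big)\begin{pmatrix}z^nI_N&0\\0&z^{-n}I_N\end{pmatrix}$, $z\to\infty$, and $(Y_1^n)_{jk}$ are its $N\times N$ blocks. *)

(* Defs.v *)
From HB Require Import structures.
From mathcomp Require Import all_boot all_order all_algebra.
From mathcomp Require Import sesquilinear spectral complex.
From mathcomp Require Import all_classical all_reals all_analysis.
Import Order.TTheory GRing.Theory Num.Theory.
Import numFieldNormedType.Exports.
Import Normc.

Set Implicit Arguments.
Unset Strict Implicit.
Unset Printing Implicit Defensive.

Local Open Scope classical_set_scope.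
Local Open Scope complex_scope.
Local Open Scope sesquilinear_scope.
Local Open Scope ring_scope.

(* Blocks have size N.+1, so that 'M_N.+1 is a (unit) ring; this is exactly
   the range of block sizes >= 1. Matrix polynomials are elements of
   {poly 'M[R[i]]_N.+1}: their coefficients act on the left and they are
   evaluated at scalar matrices. *)

Section Weight.
Variables (R : realType) (N : nat).
Implicit Types (a b c x : R^o).

(* The endpoints are extended reals, so that unbounded intervals are allowed. *)
Definition oitv (a b : \bar R) : set R := [set x | (a < x%:E < b)%E].

Definition citv (a b : \bar R) : set R := [set x | (a <= x%:E <= b)%E].

Definition posdef (A : 'M[R]_N.+1) : Prop :=
  A^T = A /\ forall u : 'rV[R]_N.+1, u != 0 -> 0 < (u *m A *m u^T) ord0 ord0.

Definition finite_moments (D : set R) (f : R -> R) : Prop :=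
  forall k : nat, (@lebesgue_measure R).-integrable D (fun x => (x ^+ k * f x)%:E).

(* Boundedness of the regular factor is only required near c: when both
   endpoints are finite, the factor attached to one endpoint carries the
   algebraic singularity of the other one. *)
Definition endpoint_behaviour (a b : \bar R) (W : R -> 'M[R]_N.+1) (c : R) :
    Prop :=
  exists (s : R) (Wt : R -> 'M[R]_N.+1),
    [/\ -1 < s,
        forall x, x \in oitv a b -> W x = (`|x - c| `^ s) *: Wt x,
        forall i j, exists M : R,
          \forall x \near within (oitv a b) (nbhs c), `|Wt x i j| <= M,
        forall i j, {within oitv a b `|` [set c], continuous (fun x => Wt x i j)}
      & Wt c != 0].

Record is_weight (a b : \bar R) (W : R -> 'M[R]_N.+1) : Prop := IsWeight {
  weight_continuous : forall i j x, x \in oitv a b ->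
    {for x, continuous (fun y => W y i j)};
  weight_derivable : forall i j x, x \in oitv a b ->
    derivable (fun y : R^o => W y i j : R^o) x 1;
  weight_posdef : forall x, x \in oitv a b -> posdef (W x);
  weight_moments : forall i j, finite_moments (oitv a b) (fun x => W x i j);
  weight_deriv_moments : forall i j,
    finite_moments (oitv a b) (fun y : R^o => W y i j : R^o)^`()%classic;
  weight_endpoints : forall c, c%:E = a \/ c%:E = b -> endpoint_behaviour a b W c
}.

End Weight.

Section RiemannHilbert.
Variables (R : realType) (N : nat) (a b : \bar R) (W : R -> 'M[R]_N.+1).

Local Notation C := R[i].
Local Notation M := 'M[R[i]]_N.+1.
Local Notation M2 := 'M[R[i]]_(N.+1 + N.+1).

Definition two_pi_i : C := 0 +i* (2 * pi).

Definition cint (f : R -> C) : C :=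
  Rintegral (@lebesgue_measure R) (oitv a b) (fun t => complex.Re (f t))
  +i* Rintegral (@lebesgue_measure R) (oitv a b) (fun t => complex.Im (f t)).

Definition mxint (F : R -> M) : M := \matrix_(i, j) cint (fun t => F t i j).

Definition weightC (t : R) : M := map_mx (real_complex R) (W t).

Definition mxeval (p : {poly M}) (z : C) : M := p.[z%:M].

Definition mxinner (p q : {poly M}) : M :=
  mxint (fun t => mxeval p t%:C * weightC t * (mxeval q t%:C)^t*).

Definition is_monic_OP (n : nat) (p : {poly M}) : Prop :=
  [/\ p \is monic, size p = n.+1 &
      forall q : {poly M}, (size q <= n)%N -> mxinner p q = 0].

Definition cauchy_transform (F : R -> M) (z : C) : M :=
  two_pi_i^-1 *: mxint (fun t => (t%:C - z)^-1 *: F t).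

Definition off_cut (z : C) : Prop := forall t, t \in citv a b -> z <> t%:C.

(* The sequence n |-> u_(n-1), with the convention u_(-1) = 0. *)
Definition prevseq (V : nmodType) (u : nat -> V) (n : nat) : V :=
  if n is m.+1 then u m else 0.

Variable P : nat -> {poly M}.

Definition gam (n : nat) : M := (mxinner (P n) (P n))^-1.

(* n |-> a_(n, n-1), with a_(0, -1) = 0. *)
Definition subcoef (n : nat) : M := prevseq (fun m => (P m.+1)`_m) n.

Definition RHY (n : nat) (z : C) : M2 :=
  if n is m.+1 then
    block_mx (mxeval (P n) z)
             (cauchy_transform (fun t => mxeval (P n) t%:C * weightC t) z)
             (- two_pi_i *: (gam m * mxeval (P m) z))
             (- two_pi_i *:
                (gam m * cauchy_transform (fun t => mxeval (P m) t%:C * weightC t) z))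
  else block_mx 1 (cauchy_transform weightC z) 0 1.

(* Y^n(z) = (I + Y1 / z + O(1/z^2)) diag(z^n I, z^-n I) as z -> oo, the limit
   being taken within each region dist(z, [a, b]) >= eps * |z|. If (a, b) is
   bounded, then for eps = 1/2 this region contains every z of large enough
   modulus and the expansion is the unrestricted one. If (a, b) is unbounded,
   z has to stay in a sector away from the unbounded part of the cut (as usual
   for Cauchy transforms): the remainder of the Cauchy transform of a weight
   with finite moments need not be uniform up to the cut. *)
Definition RH_expansion (n : nat) (Y1 : M2) : Prop :=
  forall eps : R, 0 < eps ->
  exists K r : R, 0 < r /\
    forall z : C, r <= normc z ->
      (forall t, t \in citv a b -> eps * normc z <= normc (z - t%:C)) ->
    exists E : M2,
      RHY n z = (1%:M + z^-1 *: Y1 + E)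
                *m block_mx (z ^+ n)%:M 0 0 (z ^- n)%:M
      /\ forall i j, normc (E i j) <= K / normc z ^+ 2.

Definition RHY1 (n : nat) : M2 := xget 0 [set Y1 | RH_expansion n Y1].

Definition Y1_11 (n : nat) : M := ulsubmx (RHY1 n).
Definition Y1_12 (n : nat) : M := ursubmx (RHY1 n).
Definition Y1_21 (n : nat) : M := dlsubmx (RHY1 n).

Definition transfer (alpha : nat -> M) (n : nat) (z : C) : M2 :=
  block_mx (z%:M - alpha n) (two_pi_i^-1 *: (gam n)^-1)
           (- two_pi_i *: gam n) 0.

Definition transfer_relation (alpha : nat -> M) : Prop :=
  forall n z, off_cut z -> RHY n.+1 z = transfer alpha n z *m RHY n z.

End RiemannHilbert.

(* Main.v *)
(* The functional L(p) = int p W is left linear, and <p, q> is a combination of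
   the L(p X^k). Positivity of W makes <p, p> = 0 force p = 0, so the norms
   <P_n, P_n> are invertible and comparing coefficients and moments gives the
   three-term recurrence. The Stieltjes transform S(p) = int p(t) W(t)/(t - z) dt
   satisfies S(p X) = z S(p) + L(p); applied to the recurrence this carries it
   over to the second block column of Y^n, which is the transfer relation.
   Iterating the same identity, z^(n+1) S(P_n) = S(P_n X^(n+1)) - <P_n, P_n>
   because the lower moments of P_n vanish, and S(p) is O(1/z) away from the
   cut: this is the expansion at infinity. Its 1/z coefficient is unique because
   two expansions can be compared along z = iy. *)

Require Import Defs.
From HB Require Import structures.
From mathcomp Require Import all_boot all_order all_algebra.
From mathcomp Require Import sesquilinear spectral complex.
From mathcomp Require Import all_classical all_reals all_analysis.
From mathcomp Require Import measurable_realfun.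
Import Order.TTheory GRing.Theory Num.Theory.
Import numFieldNormedType.Exports.

Set Implicit Arguments.
Unset Strict Implicit.
Unset Printing Implicit Defensive.

Local Open Scope ring_scope.

(** * Complex numbers through real and imaginary parts, and estimates for the modulus *)

Section ComplexParts.
Variable R : rcfType.
Implicit Types x y : R[i].

Lemma ReD x y : complex.Re (x + y) = complex.Re x + complex.Re y.
Proof. by case: x y => [? ?] []. Qed.

Lemma ImD x y : complex.Im (x + y) = complex.Im x + complex.Im y.
Proof. by case: x y => [? ?] []. Qed.

Lemma ReM x y : complex.Re (x * y) =
  complex.Re x * complex.Re y - complex.Im x * complex.Im y.
Proof. by case: x y => [? ?] []. Qed.

Lemma ImM x y : complex.Im (x * y) =
  complex.Re x * complex.Im y + complex.Im x * complex.Re y.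
Proof. by case: x y => [? ?] []. Qed.

Lemma complex_eq x y :
  complex.Re x = complex.Re y -> complex.Im x = complex.Im y -> x = y.
Proof. by case: x y => [? ?] [? ?] /= -> ->. Qed.

Lemma normc_sqrt x : Normc.normc x =
  Num.sqrt (complex.Re x ^+ 2 + complex.Im x ^+ 2).
Proof. by case: x. Qed.

Lemma normc_ge0 x : 0 <= Normc.normc x.
Proof. by rewrite normc_sqrt sqrtr_ge0. Qed.

Lemma normc_eq0 x : (Normc.normc x == 0) = (x == 0).
Proof.
by apply/eqP/eqP => [/Normc.eq0_normc//|->]; rewrite Normc.normc0.
Qed.

Lemma normr_Re_le x : `|complex.Re x| <= Normc.normc x.
Proof. by rewrite normc_sqrt -sqrtr_sqr ler_wsqrtr// lerDl sqr_ge0. Qed.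

Lemma normr_Im_le x : `|complex.Im x| <= Normc.normc x.
Proof. by rewrite normc_sqrt -sqrtr_sqr ler_wsqrtr// lerDr sqr_ge0. Qed.

Lemma normc_le_ReIm x :
  Normc.normc x <= `|complex.Re x| + `|complex.Im x|.
Proof.
rewrite normc_sqrt -[leRHS]ger0_norm ?addr_ge0// -[leRHS]sqrtr_sqr ler_wsqrtr//.
by rewrite sqrrD !real_normK ?num_real// -addrA lerD2l lerDr mulrn_wge0// mulr_ge0.
Qed.

Lemma normc_le_sum (I : Type) (s : seq I) (P : pred I) (F : I -> R[i]) :
  Normc.normc (\sum_(i <- s | P i) F i) <= \sum_(i <- s | P i) Normc.normc (F i).
Proof.
elim/big_rec2: _ => [|i x y _ h]; first by rewrite Normc.normc0.
by apply: (le_trans (@le_normcD _ _ _)); rewrite lerD2l.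
Qed.

Lemma normcX x n : Normc.normc (x ^+ n) = Normc.normc x ^+ n.
Proof.
elim: n => [|n ih]; first by rewrite !expr0 Normc.normc1.
by rewrite !exprS Normc.normcM ih.
Qed.

End ComplexParts.

(** * Integration of complex-valued functions over the interval *)

Section ComplexIntegral.
Variables (R : realType) (a b : \bar R).
Local Notation D := (oitv a b).
Local Notation mu := (@lebesgue_measure R).
Implicit Types (f g : R -> R[i]).

(** The real interval is the preimage under [EFin] of an interval of extended reals, which treats
    finite and infinite endpoints alike. *)
Lemma measurable_oitv : measurable (D : set (measurableTypeR R)).
Proof.
have mI := emeasurable_itv `]a, b[%O.
rewrite (_ : D = setT `&` EFin @^-1` [set` `]a, b[%O])%classic.
  exact: (@EFin_measurable R setT measurableT).
by rewrite setTI; apply/seteqP; split => x /=; rewrite in_itv.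
Qed.

(** [cint] is a total function, so its linearity holds only under this side condition, stated part
    by part as [cint] itself is. *)
Definition cintegrable f :=
  mu.-integrable D (fun t => (complex.Re (f t))%:E) /\
  mu.-integrable D (fun t => (complex.Im (f t))%:E).

Lemma eq_cintegrable f g : (forall t, t \in D -> f t = g t) ->
  cintegrable f -> cintegrable g.
Proof.
by move=> fg [hr hi]; split; [apply: eq_integrable hr|apply: eq_integrable hi];
  rewrite ?inE//; try exact: measurable_oitv; move=> t tD; rewrite fg.
Qed.

Lemma eq_cint f g : (forall t, t \in D -> f t = g t) ->
  cint a b f = cint a b g.
Proof. by move=> fg; congr Complex; apply: eq_Rintegral => t tD; rewrite fg. Qed.

Lemma cintegrable0 : cintegrable (fun=> 0).
Proof. by split; exact: integrable0. Qed.

Lemma cintegrableD f g :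
  cintegrable f -> cintegrable g -> cintegrable (fun t => f t + g t).
Proof.
have mD := measurable_oitv.
move=> [fr fi] [gr gi]; split.
- under eq_fun do rewrite ReD EFinD; exact: integrableD.
- under eq_fun do rewrite ImD EFinD; exact: integrableD.
Qed.

Lemma cintegrableZ c f : cintegrable f -> cintegrable (fun t => c * f t).
Proof.
have mD := measurable_oitv.
move=> [fr fi]; split.
- under eq_fun do rewrite ReM EFinB !EFinM.
  by apply: integrableB => //; exact: integrableZl.
- under eq_fun do rewrite ImM EFinD !EFinM.
  by apply: integrableD => //; exact: integrableZl.
Qed.

Lemma cintegrable_sum (I : Type) (s : seq I) (F : I -> R -> R[i]) :
  (forall i, cintegrable (F i)) -> cintegrable (fun t => \sum_(i <- s) F i t).
Proof.
move=> hF; elim: s => [|i s ih].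
  by under eq_fun do rewrite big_nil; exact: cintegrable0.
by under eq_fun do rewrite big_cons; exact: cintegrableD.
Qed.

Lemma cintD f g : cintegrable f -> cintegrable g ->
  cint a b (fun t => f t + g t) = cint a b f + cint a b g.
Proof.
have mD := measurable_oitv.
move=> [fr fi] [gr gi]; apply: complex_eq; rewrite ?ReD ?ImD /=.
- by under eq_Rintegral do rewrite ReD; rewrite RintegralD.
- by under eq_Rintegral do rewrite ImD; rewrite RintegralD.
Qed.

Lemma cintZ c f : cintegrable f -> cint a b (fun t => c * f t) = c * cint a b f.
Proof.
have mD := measurable_oitv.
move=> [fr fi].
have iZ (k : R) (u : R -> R) : mu.-integrable D (EFin \o u) ->
    mu.-integrable D (EFin \o (fun t => k * u t)).
  by move=> iu; exact: (integrableZl mD k iu).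
apply: complex_eq; rewrite ?ReM ?ImM /=.
- under eq_Rintegral do rewrite ReM.
  by rewrite RintegralB ?RintegralZl//; exact: iZ.
- under eq_Rintegral do rewrite ImM.
  by rewrite RintegralD ?RintegralZl//; exact: iZ.
Qed.

Lemma cint0 : cint a b (fun=> 0) = 0.
Proof.
by rewrite /cint /= /Rintegral integral0.
Qed.

Lemma cint_sum (I : Type) (s : seq I) (F : I -> R -> R[i]) :
  (forall i, cintegrable (F i)) ->
  cint a b (fun t => \sum_(i <- s) F i t) = \sum_(i <- s) cint a b (F i).
Proof.
move=> hF; elim: s => [|i s ih].
  by under eq_cint do rewrite big_nil; rewrite big_nil cint0.
under eq_cint do rewrite big_cons.
by rewrite big_cons cintD ?ih//; exact: cintegrable_sum.
Qed.

Lemma cintegrable_real (f : R -> R) : mu.-integrable D (EFin \o f) ->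
  cintegrable (fun t => (f t)%:C%C).
Proof. by move=> hf; split => //=; exact: integrable0. Qed.

(** Both parts of [h] are bounded by [K], so each of the four real products is a bounded measurable
    function times an integrable one. The intended [h] is the Cauchy kernel. *)
Lemma cintegrableM (h : R -> R[i]) f K :
  measurable_fun (D : set (measurableTypeR R)) (fun t => complex.Re (h t)) ->
  measurable_fun (D : set (measurableTypeR R)) (fun t => complex.Im (h t)) ->
  (forall t, t \in D -> Normc.normc (h t) <= K) ->
  cintegrable f -> cintegrable (fun t => h t * f t).
Proof.
have mD := measurable_oitv.
move=> mr mi hK [fr fi].
have bnd (g : R -> R) : (forall t, `|g t| <= Normc.normc (h t)) ->
    [bounded g x | x in D].
  move=> gh; exists K; split; first exact: num_real.
  move=> M KM t tD; apply: (le_trans (gh t)).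
  by rewrite (le_trans (hK t _)) ?ltW// inE.
have br := bnd _ (fun t => normr_Re_le (h t)).
have bi := bnd _ (fun t => normr_Im_le (h t)).
split.
- under eq_fun do rewrite ReM EFinB !EFinM.
  by apply: integrableB => //;
    [exact: (integrableMr mD mr br fr)|exact: (integrableMr mD mi bi fi)].
- under eq_fun do rewrite ImM EFinD !EFinM.
  by apply: integrableD => //;
    [exact: (integrableMr mD mr br fi)|exact: (integrableMr mD mi bi fr)].
Qed.

(** The factor 2 comes from estimating the real and imaginary integrals separately; it is harmless
    for O-bounds. *)
Lemma normc_cint_le f (g : R -> R) : cintegrable f ->
  mu.-integrable D (EFin \o g) ->
  (forall t, t \in D -> Normc.normc (f t) <= g t) ->
  Normc.normc (cint a b f) <= 2 * Rintegral mu D g.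
Proof.
have mD := measurable_oitv.
move=> [fr fi] ig fg; apply: (le_trans (normc_le_ReIm _)).
have le (u : R -> R) : mu.-integrable D (EFin \o u) ->
    (forall t, `|u t| <= Normc.normc (f t)) ->
    `|Rintegral mu D u| <= Rintegral mu D g.
  move=> iu uf; apply: (le_trans (le_normr_Rintegral mD iu)).
  apply: le_Rintegral => //.
    exact: (integrable_norm iu).
  by move=> t tD; apply: (le_trans (uf t)); apply: fg; rewrite inE.
rewrite mulr_natl mulr2n; apply: lerD => /=; apply: le => // t.
- exact: normr_Re_le.
- exact: normr_Im_le.
Qed.

End ComplexIntegral.

(** * Entrywise integration of matrices, linear over constant matrices on both sides *)

Section MatrixIntegral.
Variables (R : realType) (N : nat) (a b : \bar R).
Local Notation D := (oitv a b).
Local Notation M := 'M[R[i]]_N.+1.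
Implicit Types (F G : R -> M).

Definition mxintegrable F := forall i j, cintegrable a b (fun t => F t i j).

Lemma eq_mxint F G : (forall t, t \in D -> F t = G t) ->
  mxint a b F = mxint a b G.
Proof.
by move=> FG; apply/matrixP => i j; rewrite !mxE; apply: eq_cint => t /FG ->.
Qed.

Lemma eq_mxintegrable F G : (forall t, t \in D -> F t = G t) ->
  mxintegrable F -> mxintegrable G.
Proof. by move=> FG iF i j; apply: eq_cintegrable (iF i j) => t /FG ->. Qed.

Lemma mxintegrable_sum (I : Type) (s : seq I) (F : I -> R -> M) :
  (forall i, mxintegrable (F i)) -> mxintegrable (fun t => \sum_(i <- s) F i t).
Proof.
move=> iF i j; under eq_fun do rewrite summxE.
by apply: cintegrable_sum => k; exact: iF.
Qed.

Lemma mxintegrableMl A F : mxintegrable F -> mxintegrable (fun t => A * F t).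
Proof.
move=> iF i j; under eq_fun do rewrite -mulmxE mxE.
by apply: cintegrable_sum => k; exact: cintegrableZ.
Qed.

Lemma mxintegrableMr A F : mxintegrable F -> mxintegrable (fun t => F t * A).
Proof.
move=> iF i j; under eq_fun do rewrite -mulmxE mxE.
apply: cintegrable_sum => k; under eq_fun do rewrite mulrC.
exact: cintegrableZ.
Qed.

Lemma mxintegrableZ c F : mxintegrable F -> mxintegrable (fun t => c *: F t).
Proof.
by move=> iF i j; under eq_fun do rewrite mxE; exact: cintegrableZ.
Qed.

Lemma mxint0 : mxint a b (fun=> 0 : M) = 0.
Proof.
by apply/matrixP => i j; rewrite !mxE cint0.
Qed.

Lemma mxintD F G : mxintegrable F -> mxintegrable G ->
  mxint a b (fun t => F t + G t) = mxint a b F + mxint a b G.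
Proof.
move=> iF iG; apply/matrixP => i j; rewrite !mxE -cintD//.
by apply: eq_cint => t _; rewrite mxE.
Qed.

Lemma mxint_sum (I : Type) (s : seq I) (F : I -> R -> M) :
  (forall i, mxintegrable (F i)) ->
  mxint a b (fun t => \sum_(i <- s) F i t) = \sum_(i <- s) mxint a b (F i).
Proof.
move=> iF; elim: s => [|i s ih].
  by rewrite big_nil -[RHS]mxint0; apply: eq_mxint => t _; rewrite big_nil.
rewrite big_cons -ih -mxintD//; last exact: mxintegrable_sum.
by apply: eq_mxint => t _; rewrite big_cons.
Qed.

Lemma mxintMl A F : mxintegrable F ->
  mxint a b (fun t => A * F t) = A * mxint a b F.
Proof.
move=> iF; apply/matrixP => i j; rewrite !mxE.
under eq_cint do rewrite -mulmxE mxE.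
rewrite cint_sum => [|k]; last exact: cintegrableZ.
by apply: eq_bigr => k _; rewrite cintZ// mxE.
Qed.

Lemma mxintMr A F : mxintegrable F ->
  mxint a b (fun t => F t * A) = mxint a b F * A.
Proof.
move=> iF; apply/matrixP => i j; rewrite !mxE.
under eq_cint => t _ do (rewrite -mulmxE mxE; under eq_bigr do rewrite mulrC).
rewrite cint_sum => [|k]; last exact: cintegrableZ.
by apply: eq_bigr => k _; rewrite cintZ// mxE mulrC.
Qed.

Lemma mxintZ c F : mxintegrable F ->
  mxint a b (fun t => c *: F t) = c *: mxint a b F.
Proof.
move=> iF; apply/matrixP => i j; rewrite !mxE -cintZ//.
by apply: eq_cint => t _; rewrite mxE.
Qed.

End MatrixIntegral.

(** * Evaluation of matrix polynomials at scalars *)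

Section MatrixEvaluation.
Variables (R : realType) (N : nat).
Local Notation M := 'M[R[i]]_N.+1.
Implicit Types (p q : {poly M}) (z : R[i]) (A : M).

Lemma mxeval_coef p z : mxeval p z = \sum_(k < size p) z ^+ k *: p`_k.
Proof.
rewrite /mxeval horner_coef; apply: eq_bigr => k _.
by rewrite -rmorphXn -[RHS]mul_mx_scalar.
Qed.

Lemma mxevalD p q z : mxeval (p + q) z = mxeval p z + mxeval q z.
Proof. exact: hornerD. Qed.

Lemma mxevalN p z : mxeval (- p) z = - mxeval p z.
Proof. exact: hornerN. Qed.

Lemma mxevalMl A p z : mxeval (A%:P * p) z = A * mxeval p z.
Proof. exact: hornerCM. Qed.

Lemma mxevalMX p z : mxeval (p * 'X) z = z *: mxeval p z.
Proof. by rewrite /mxeval hornerMX -[RHS]mul_mx_scalar. Qed.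

Lemma mxevalMXn p k z : mxeval (p * 'X^k) z = z ^+ k *: mxeval p z.
Proof.
elim: k => [|k ih]; first by rewrite expr0 mulr1 scale1r.
by rewrite exprSr mulrA mxevalMX ih scalerA -exprS.
Qed.

Lemma mxeval1 z : mxeval (1 : {poly M}) z = 1.
Proof. exact: hornerC. Qed.

Definition adjmx A : M := (A ^t* )%sesqui.

(** Conjugation fixes the real point [t], so the adjoint only affects the coefficients. *)
Lemma adjmx_mxeval p (t : R) :
  adjmx (mxeval p t%:C%C) = \sum_(k < size p) (t%:C%C) ^+ k *: adjmx p`_k.
Proof.
apply/matrixP => i j; rewrite mxeval_coef !mxE !summxE rmorph_sum.
apply: eq_bigr => k _; rewrite !mxE rmorphM rmorphXn; congr (_ ^+ _ * _).
exact: conjc_real.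
Qed.

End MatrixEvaluation.

(** * The moment functional, the inner product and the Stieltjes transform of the weight *)

Section WeightedIntegral.
Variables (R : realType) (N : nat) (a b : \bar R) (W : R -> 'M[R]_N.+1).
Hypothesis W_moments : forall i j, finite_moments (oitv a b) (fun x => W x i j).
Local Notation D := (oitv a b).
Local Notation M := 'M[R[i]]_N.+1.
Implicit Types (p q : {poly M}) (z : R[i]) (A : M).

Definition polyW p (t : R) : M := mxeval p t%:C%C * weightC W t.

(** The functional $L$, with values in matrices. *)
Definition intW p : M := mxint a b (polyW p).

Lemma polyWD p q t : polyW (p + q) t = polyW p t + polyW q t.
Proof. by rewrite /polyW mxevalD mulrDl. Qed.

Lemma polyWMl A p t : polyW (A%:P * p) t = A * polyW p t.
Proof. by rewrite /polyW mxevalMl mulrA. Qed.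

Lemma polyWMX p t : polyW (p * 'X) t = t%:C%C *: polyW p t.
Proof. by rewrite /polyW mxevalMX -scalerAl. Qed.

Lemma polyWMXn p k t : polyW (p * 'X^k) t = t%:C%C ^+ k *: polyW p t.
Proof. by rewrite /polyW mxevalMXn -scalerAl. Qed.

Lemma mxintegrable_moment k :
  mxintegrable a b (fun t => t%:C%C ^+ k *: weightC W t).
Proof.
move=> i j.
apply: (@eq_cintegrable _ _ _ (fun t => (t ^+ k * W t i j)%:C%C)).
  by move=> t _; rewrite !mxE -rmorphXn -rmorphM.
exact/cintegrable_real/W_moments.
Qed.

(** The integrand is a finite combination, with constant left factors, of the integrands of the
    moments of $W$. *)
Lemma mxintegrable_polyW p : mxintegrable a b (polyW p).
Proof.
apply: (@eq_mxintegrable _ _ _ _ (fun t => \sum_(k < size p)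
    p`_k * (t%:C%C ^+ k *: weightC W t))).
  move=> t _; rewrite /polyW mxeval_coef mulr_suml; apply: eq_bigr => k _.
  by rewrite -scalerAl -scalerAr.
by apply: mxintegrable_sum => k; apply/mxintegrableMl/mxintegrable_moment.
Qed.
Local Hint Resolve mxintegrable_polyW : core.

Lemma intWD p q : intW (p + q) = intW p + intW q.
Proof. by rewrite -mxintD//; apply: eq_mxint => t _; rewrite polyWD. Qed.

Lemma intWMl A p : intW (A%:P * p) = A * intW p.
Proof.
rewrite -(mxintMl A (mxintegrable_polyW p)); apply: eq_mxint => t _.
exact: polyWMl.
Qed.

Lemma intWN p : intW (- p) = - intW p.
Proof. by rewrite -[- p]mulN1r -polyCN intWMl mulN1r. Qed.

Lemma polyW_adjmx p q t : polyW p t * adjmx (mxeval q t%:C%C) =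
  \sum_(k < size q) polyW (p * 'X^k) t * adjmx q`_k.
Proof.
rewrite adjmx_mxeval mulr_sumr; apply: eq_bigr => k _.
by rewrite polyWMXn -scalerAr -scalerAl.
Qed.

Lemma mxintegrable_inner p q :
  mxintegrable a b (fun t => polyW p t * adjmx (mxeval q t%:C%C)).
Proof.
apply: (@eq_mxintegrable _ _ _ _ (fun t => \sum_(k < size q)
    polyW (p * 'X^k) t * adjmx q`_k)).
  by move=> t _; rewrite polyW_adjmx.
by apply: mxintegrable_sum => k; exact: mxintegrableMr.
Qed.

(** Moving the powers of $t$ from $q^*$ over to $p$ leaves constant right factors. Orthogonality
    thereby becomes a statement about moments. *)
Lemma mxinner_intW p q :
  mxinner a b W p q = \sum_(k < size q) intW (p * 'X^k) * adjmx q`_k.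
Proof.
transitivity (mxint a b (fun t => \sum_(k < size q)
    polyW (p * 'X^k) t * adjmx q`_k)).
  by apply: eq_mxint => t _; rewrite -polyW_adjmx.
rewrite mxint_sum => [|k]; last exact: mxintegrableMr.
by apply: eq_bigr => k _; rewrite mxintMr.
Qed.

(** A quantitative form of [off_cut]: the Cauchy kernel at [z] is bounded by $1/d$ on the
    interval. *)
Definition away (d : R) z :=
  0 < d /\ forall t, t \in D -> d <= Normc.normc (t%:C%C - z).

(** For nonreal [z] take $d=|\mathrm{Im}\,z|$. A real [z] off the cut lies strictly beyond a finite
    endpoint, and [d] is its distance to that endpoint. *)
Lemma off_cut_away z : (a < b)%E -> off_cut a b z -> exists d, away d z.
Proof.
move=> ab; case: z => x y zoff.
have [y0|y0] := eqVneq y 0; last first.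
  exists `|y|; split; first by rewrite normr_gt0.
  by move=> t _; rewrite (le_trans _ (normr_Im_le _))//= sub0r normrN.
rewrite y0 in zoff *.
have nx : ~ citv a b x by move=> xab; apply: (zoff x) => //; rewrite inE.
have bound (d : R) : 0 < d -> (forall t, t \in D -> d <= `|t - x|) ->
    exists d, away d (x +i* 0)%C.
  move=> d0 hd; exists d; split => // t tD.
  by rewrite (le_trans (hd t tD))// (le_trans _ (normr_Re_le _)).
have [ax|xa] := leP a x%:E; last first.
  case: a xa ab bound => [r||]; rewrite ?ltNge ?leey ?leNye//.
  rewrite -ltNge lte_fin => xr _ bound.
  apply: (bound (r - x)); rewrite ?subr_gt0// => t; rewrite inE => /andP[rt _].
  rewrite lte_fin in rt; rewrite gtr0_norm ?subr_gt0 ?(lt_trans xr)//.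
  by rewrite lerD2r ltW.
have [xb|bx] := leP x%:E b.
  by case: nx; rewrite /citv /= ax xb.
case: b bx ab bound => [r||]; rewrite ?ltNge ?leey ?leNye//.
rewrite -ltNge lte_fin => rx _ bound.
apply: (bound (x - r)); rewrite ?subr_gt0// => t; rewrite inE => /andP[_ tr].
rewrite lte_fin in tr; rewrite distrC gtr0_norm ?subr_gt0 ?(lt_trans tr)//.
by rewrite lerD2l lerN2 ltW.
Qed.

(** The Cauchy transform of $pW$ without the factor $1/(2\pi i)$. *)
Definition stieltjes p z : M :=
  mxint a b (fun t => (t%:C%C - z)^-1 *: polyW p t).

Lemma away_neq0 d z t : away d z -> t \in D -> t%:C%C - z != 0.
Proof.
move=> [d0 dz] tD; rewrite -normc_eq0 gt_eqF//.
exact: lt_le_trans (dz t tD).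
Qed.

Lemma mxintegrable_stieltjes d p z : away d z ->
  mxintegrable a b (fun t => (t%:C%C - z)^-1 *: polyW p t).
Proof.
move=> dz i j; under eq_fun do rewrite mxE.
case: z dz => x y dz.
(* The inverse of $|t-z|^2$ is written as a real power so that [measurable_powR] applies; the kernel
   has parts $(t-x)\,$[den] and $y\,$[den]. *)
pose den (t : R) := ((t - x) ^+ 2 + y ^+ 2) `^ (-1).
have denE t : den t = ((t - x) ^+ 2 + y ^+ 2)^-1.
  by rewrite /den powR_inv1// addr_ge0 ?sqr_ge0.
have mden : measurable_fun setT den.
  apply: (@measurableT_comp _ _ _ _ _ _ (fun r => r `^ (-1))).
    exact: measurable_powR.
  apply: measurable_funD => //.
  by apply: measurable_funX; exact: measurable_funB.
apply: (@cintegrableM _ _ _ _ _ d^-1) (mxintegrable_polyW p i j).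
- apply: (@measurable_funS _ _ _ _ setT) => //.
  rewrite (_ : (fun _ => _) = (fun t => (t - x) * den t)).
    by apply: measurable_funM => //; exact: measurable_funB.
  by apply/funext => t; rewrite denE /= sub0r sqrrN.
- apply: (@measurable_funS _ _ _ _ setT) => //.
  rewrite (_ : (fun _ => _) = (fun t => y * den t)).
    by apply: measurable_funM.
  by apply/funext => t; rewrite denE /= sub0r sqrrN mulNr opprK.
- move=> t tD; have [d0 hd] := dz; rewrite Normc.normcV lef_pV2 ?posrE//.
    exact: hd.
  exact: lt_le_trans (hd t tD).
Qed.

Lemma stieltjesD d p q z : away d z ->
  stieltjes (p + q) z = stieltjes p z + stieltjes q z.
Proof.
move=> dz; rewrite -mxintD; try exact: mxintegrable_stieltjes dz.
by apply: eq_mxint => t _; rewrite polyWD scalerDr.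
Qed.

Lemma stieltjesMl d A p z : away d z ->
  stieltjes (A%:P * p) z = A * stieltjes p z.
Proof.
move=> dz; rewrite -(mxintMl A (mxintegrable_stieltjes p dz)).
by apply: eq_mxint => t _; rewrite polyWMl scalerAr.
Qed.

(** Write $t=(t-z)+z$ under the integral: the first summand cancels the kernel. *)
Lemma stieltjesMX d p z : away d z ->
  stieltjes (p * 'X) z = z *: stieltjes p z + intW p.
Proof.
move=> dz; have iS := mxintegrable_stieltjes p dz.
rewrite -(mxintZ z iS) -(mxintD (mxintegrableZ z iS) (mxintegrable_polyW p)).
apply: eq_mxint => t tD; rewrite polyWMX !scalerA -[X in _ = _ + X]scale1r -scalerDl.
congr (_ *: _); have tz := away_neq0 dz tD.
by rewrite -[X in _ = _ + X](mulVf tz) [z * _]mulrC -mulrDr subrKC.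
Qed.

(* Iterating t/(t - z) = 1 + z/(t - z). *)
Lemma stieltjesMXn d p k z : away d z ->
  stieltjes (p * 'X^k) z = z ^+ k *: stieltjes p z
    + \sum_(j < k) z ^+ (k - j.+1) *: intW (p * 'X^j).
Proof.
move=> dz; elim: k => [|k ih].
  by rewrite !expr0 mulr1 scale1r big_ord0 addr0.
rewrite exprSr mulrA (stieltjesMX _ dz) ih scalerDr scalerA -exprS -addrA.
congr (_ + _); rewrite big_ord_recr /= subnn expr0 scale1r; congr (_ + _).
rewrite scaler_sumr; apply: eq_bigr => j _.
by rewrite scalerA -exprS -subSn.
Qed.

(** The point is that [K] depends on [p] alone: the kernel is at most $1/d$, and the rest is the
    integral of $|pW|$. With [d] proportional to $|z|$ this yields $O(1/z)$. *)
Lemma stieltjes_bound p : exists2 K : R, 0 <= K & forall d z, away d z ->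
  forall i j, Normc.normc (stieltjes p z i j) <= K / d.
Proof.
pose g i j (t : R) : R := `|complex.Re (polyW p t i j)| + `|complex.Im (polyW p t i j)|.
have g0 i j t : 0 <= g i j t by rewrite addr_ge0.
pose K i j := 2 * Rintegral (@lebesgue_measure R) D (g i j).
have K0 i j : 0 <= K i j by rewrite mulr_ge0// Rintegral_ge0.
have mD := measurable_oitv a b.
have ig i j : (@lebesgue_measure R).-integrable D (EFin \o g i j).
  have [hr hi] := mxintegrable_polyW p i j.
  have := integrableD mD (integrable_norm hr) (integrable_norm hi).
  by apply: eq_integrable.
(* Summing over all entries gives one constant that serves every [i] and [j]. *)
exists (\sum_i \sum_j K i j).
  by apply: sumr_ge0 => i _; apply: sumr_ge0.
move=> d z dz i j; have [d0 hd] := dz.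
apply: (@le_trans _ _ (K i j / d)); last first.
  apply: ler_wpM2r; first by rewrite invr_ge0 ltW.
  rewrite (bigD1 i)//= (bigD1 j)//= -addrA lerDl.
  by rewrite addr_ge0 ?sumr_ge0// => k _; rewrite sumr_ge0.
have -> : K i j / d = 2 * Rintegral (@lebesgue_measure R) D (fun t => g i j t / d).
  by rewrite (RintegralZr _ mD (ig i j)) mulrA.
rewrite /stieltjes mxE.
apply: normc_cint_le.
- exact: mxintegrable_stieltjes dz _ _.
- by apply: eq_integrable (integrableZl mD d^-1 (ig i j)) => // t _;
    rewrite -EFinM mulrC.
- move=> t tD; rewrite mxE Normc.normcM Normc.normcV mulrC.
  apply: ler_pM; rewrite ?normc_ge0 ?invr_ge0 ?normc_ge0 ?normc_le_ReIm//.
  have dt := hd t tD; rewrite lef_pV2 ?posrE//; exact: lt_le_trans dt.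
Qed.

End WeightedIntegral.

(** * Definiteness of the inner product and zeros of matrix polynomials *)

Section Positivity.
Variables (R : realType) (N : nat) (a b : \bar R) (W : R -> 'M[R]_N.+1).
Hypothesis ab : (a < b)%E.
Hypothesis hW : is_weight a b W.
Local Notation D := (oitv a b).
Local Notation M := 'M[R[i]]_N.+1.
Local Notation mu := (@lebesgue_measure R).
Implicit Types (p q : {poly M}) (z : R[i]) (A : M).

Let W_moments := weight_moments hW.

(** Provides a subset of positive finite measure even when the interval is unbounded. *)
Lemma oitv_has_itv : exists x y : R, x < y /\ (`]x, y[ `<=` D)%classic.
Proof.
have sub (x y : R) : (a <= x%:E)%E -> (y%:E <= b)%E -> (`]x, y[ `<=` D)%classic.
  move=> ax yb t /=; rewrite in_itv /= => /andP[xt ty]; apply/andP; split.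
    by apply: (le_lt_trans ax); rewrite lte_fin.
  by apply: (lt_le_trans _ yb); rewrite lte_fin.
case: a b ab sub => [r||] [s||] //; rewrite ?lte_fin => rs sub.
- by exists r, s; split => //; exact: sub.
- by exists r, (r + 1); split; [rewrite ltrDl|apply: sub; rewrite ?leey].
- by exists (s - 1), s; split; [rewrite ltrBlDr ltrDl|apply: sub; rewrite ?leNye].
- by exists 0, 1; split; [|apply: sub; rewrite ?leNye ?leey].
Qed.

(** Passing to entries gives polynomials over a field, for which the number of roots is bounded by
    the degree. *)
Definition entry_poly p i j : {poly R[i]} := \poly_(k < size p) p`_k i j.

Lemma horner_entry_poly p i j z : (entry_poly p i j).[z] = mxeval p z i j.
Proof.
rewrite horner_poly mxeval_coef summxE; apply: eq_bigr => k _.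
by rewrite mxE mulrC.
Qed.

Lemma entry_poly_eq0 p : (forall i j, entry_poly p i j = 0) -> p = 0.
Proof.
move=> p0; apply/polyP => k; apply/matrixP => i j; rewrite coef0 mxE.
have [kp|pk] := ltnP k (size p); last by rewrite nth_default// mxE.
by have := congr1 (fun q : {poly R[i]} => q`_k) (p0 i j); rewrite coef_poly kp coef0.
Qed.

(** Each entry has infinitely many roots. The upper imaginary axis is chosen because it avoids the
    cut for every interval. *)
Lemma mxeval_upper_eq0 p :
  (forall y : R, 0 < y -> mxeval p (0 +i* y)%C = 0) -> p = 0.
Proof.
move=> p0; apply: entry_poly_eq0 => i j; apply/eqP/negP => /negP r0.
pose r := entry_poly p i j.
(* The points $i,2i,3i,\dots$, one more than the degree of [r] allows as roots. *)
pose pts := [seq (0 +i* (k.+1%:R : R))%C | k <- iota 0 (size r)].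
suff: (size pts < size r)%N by rewrite size_map size_iota ltnn.
apply: max_poly_roots => //.
  apply/allP => z /mapP[k _ ->]; rewrite /root horner_entry_poly p0 ?mxE//.
rewrite map_inj_uniq ?iota_uniq// => k l [] /eqP.
by rewrite eqr_nat => /eqP[].
Qed.

Lemma finite_real_roots (q : {poly R[i]}) : q != 0 ->
  finite_set [set t : R | root q t%:C%C]%classic.
Proof.
move=> q0; have [rs qE] := closed_field_poly_normal q.
apply: (@sub_finite_set _ _ [set complex.Re r | r in [set` rs]]%classic).
  move=> t /= qt; exists t%:C%C => //=.
  by move: qt; rewrite qE rootZ ?lead_coef_eq0// root_prod_XsubC.
exact/finite_image/finite_seq.
Qed.

(** With row $i$ of [e] equal to $x+iy$, the diagonal entry is $(x+iy)W(x-iy)^T$. As $W$ is real,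
    the cross terms are purely imaginary. *)
Lemma Re_weighted_norm p t i :
  let e := mxeval p t%:C%C in
  let x : 'rV[R]_N.+1 := \row_k complex.Re (e i k) in
  let y : 'rV[R]_N.+1 := \row_k complex.Im (e i k) in
  complex.Re ((polyW W p t * adjmx e) i i) =
    (x *m W t *m x^T) 0 0 + (y *m W t *m y^T) 0 0.
Proof.
move=> e x y; rewrite !mxE -big_split /= (big_morph _ (@ReD R) erefl).
apply: eq_bigr => l _; rewrite !mxE !mulr_suml -big_split /=.
rewrite (big_morph _ (@ReD R) erefl); apply: eq_bigr => k _.
rewrite !mxE; case: (e i k) => ? ?; case: (e i l) => ? ? /=.
by rewrite !mulr0 subr0 add0r mulrN opprK.
Qed.

Lemma weighted_norm_ge0 t (x : 'rV[R]_N.+1) :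
  t \in D -> 0 <= (x *m W t *m x^T) 0 0.
Proof.
move=> tD; have [->|x0] := eqVneq x 0; first by rewrite !mul0mx mxE.
by have [_ /(_ _ x0)/ltW] := weight_posdef hW tD.
Qed.

(* The diagonal entries of p W p^* are nonnegative with zero integral, hence
   vanish almost everywhere; a nonzero entry of p has only finitely many zeros. *)
Lemma mxinner_eq0 p : mxinner a b W p p = 0 -> p = 0.
Proof.
move=> pp0; have mD := measurable_oitv a b.
apply: entry_poly_eq0 => i j; apply/eqP/negP => /negP q0.
pose h t : R := complex.Re ((polyW W p t * adjmx (mxeval p t%:C%C)) i i).
have h0 t : t \in D -> 0 <= h t.
  by move=> tD; rewrite /h Re_weighted_norm addr_ge0// weighted_norm_ge0.
(* Both quadratic forms must vanish, so positive definiteness kills the whole row [i] of $p(t)$. *)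
have hroot t : t \in D -> h t = 0 -> root (entry_poly p i j) t%:C%C.
  move=> tD; rewrite /h Re_weighted_norm => /eqP.
  rewrite paddr_eq0 ?weighted_norm_ge0// => /andP[/eqP x0 /eqP y0].
  have [_ pd] := weight_posdef hW tD.
  have zero (x : 'rV_N.+1) : (x *m W t *m x^T) 0 0 = 0 -> x = 0.
    move=> xx; apply/eqP/negP => /negP xn0.
    by have := pd x xn0; rewrite xx ltxx.
  rewrite /root horner_entry_poly; apply/eqP/complex_eq.
  - by have := congr1 (fun x : 'rV_N.+1 => x 0 j) (zero _ x0); rewrite !mxE.
  - by have := congr1 (fun x : 'rV_N.+1 => x 0 j) (zero _ y0); rewrite !mxE.
have ih : mu.-integrable D (EFin \o h).
  by have [] := mxintegrable_inner W_moments p p i i.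
have inth : (\int[mu]_(t in D) `|(EFin \o h) t|)%E = 0%E.
  have -> : (\int[mu]_(t in D) `|(EFin \o h) t|)%E = (\int[mu]_(t in D) (EFin \o h) t)%E.
    by apply: eq_integral => t tD /=; rewrite ger0_norm// h0.
  rewrite -[LHS]fineK ?integrable_fin_num//; congr EFin.
  have := congr1 (fun A : M => complex.Re (A i i)) pp0.
  by rewrite !mxE.
have [N0 hN] := (ae_eq_integral_abs mu mD (measurable_int mu ih)).1 inth.
have [x [y [xy xyD]]] := oitv_has_itv.
have nZ : mu.-negligible ([set t : R | root (entry_poly p i j) t%:C%C]%classic
    : set (measurableTypeR R)).
  have cZ := finite_set_countable (finite_real_roots q0).
  exists [set t : R | root (entry_poly p i j) t%:C%C]%classic; split => //.
  - exact: countable_measurable.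
  - exact: countable_lebesgue_measure0.
have nN : mu.-negligible
    (~` [set t : measurableTypeR R | D t -> (EFin \o h) t = cst 0%E t])%classic.
  by exists N0.
(* The interval is covered by the exceptional set, where [h] is nonzero, and the root set; this
   contradicts its positive length. *)
have : mu.-negligible (`]x, y[%classic : set (measurableTypeR R)).
  refine (negligibleS _ (negligibleU nN nZ)).
  move=> t /xyD tD; have [ht|ht] := eqVneq (h t) 0.
    by right; apply: hroot => //; rewrite inE.
  by left => /(_ tD) []; apply/eqP.
move=> /measure_negligible -/(_ (measurable_itv _)) m0.
have := etrans (esym (lebesgue_measure_itv `]x, y[%O)) m0.
rewrite /= lte_fin xy => /eqP.
by rewrite -EFinB eqe subr_eq0 gt_eqF.
Qed.

End Positivity.

(** * The three-term recurrence and the transfer relation *)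

Section Orthogonality.
Variables (R : realType) (N : nat) (a b : \bar R) (W : R -> 'M[R]_N.+1).
Hypothesis ab : (a < b)%E.
Hypothesis hW : is_weight a b W.
Variable P : nat -> {poly 'M[R[i]]_N.+1}.
Hypothesis hP : forall n, is_monic_OP a b W n (P n).
Local Notation D := (oitv a b).
Local Notation M := 'M[R[i]]_N.+1.
Local Notation intW := (intW a b W).
Local Notation gam := (gam a b W P).
Local Notation norm n := (mxinner a b W (P n) (P n)).
Implicit Types (p q : {poly M}) (z : R[i]) (A : M).

Let Wm := weight_moments hW.

Lemma adjmx1 : adjmx (1 : M) = 1.
Proof. by apply/matrixP => i j; rewrite !mxE rmorph_nat eq_sym. Qed.

Lemma size_OP n : size (P n) = n.+1.
Proof. by have [] := hP n. Qed.

Lemma lead_OP n : (P n)`_n = 1.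
Proof. by have [/monicP + sP _] := hP n; rewrite /lead_coef sP. Qed.

Lemma OP0 : P 0 = 1.
Proof. by rewrite [P 0]size1_polyC ?lead_OP// size_OP. Qed.

Lemma adjmx0 : adjmx (0 : M) = 0.
Proof. by apply/matrixP => i j; rewrite !mxE rmorph0. Qed.

Lemma mxinner_Xn p k : mxinner a b W p 'X^k = intW (p * 'X^k).
Proof.
rewrite (mxinner_intW Wm) size_polyXn big_ord_recr /= big1 => [|j _].
  by rewrite coefXn eqxx adjmx1 add0r; exact: mulr1.
by rewrite coefXn ltn_eqF//= adjmx0; exact: mulr0.
Qed.

Lemma intW_OP_Xn n k : (k < n)%N -> intW (P n * 'X^k) = 0.
Proof.
by move=> kn; have [_ _ /(_ 'X^k)] := hP n; rewrite size_polyXn mxinner_Xn => /(_ kn).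
Qed.

(** Expanding the second argument of the inner product, only its leading coefficient 1
    contributes. *)
Lemma intW_OP_lead n : intW (P n * 'X^n) = norm n.
Proof.
rewrite (mxinner_intW Wm) size_OP big_ord_recr /= big1 => [|j _].
  by rewrite lead_OP adjmx1 add0r; exact/esym/mulr1.
by rewrite intW_OP_Xn//; exact: mul0r.
Qed.

(** If $K$ annihilates the norm from the left, then $\langle KP_n,KP_n\rangle=0$. Hence $KP_n=0$,
    and the leading coefficient shows $K=0$. *)
Lemma norm_unit n : norm n \is a GRing.unit.
Proof.
rewrite -[_ \is a _]/(norm n \in unitmx) -row_free_unit -kermx_eq0.
set K := kermx _; have K0 : K * norm n = 0 by exact: mulmx_ker.
suff : K%:P * P n = 0.
  by move=> /(congr1 (fun q : {poly M} => q`_n)); rewrite coefCM lead_OP mulr1 coef0 => ->.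
apply: (mxinner_eq0 ab hW); rewrite (mxinner_intW Wm).
apply: big1 => k _; rewrite -mulrA (intWMl Wm).
have kn : (k <= n)%N.
  rewrite -ltnS; apply: (leq_trans (ltn_ord k)); rewrite mul_polyC.
  by apply: (leq_trans (size_scale_leq K (P n))); rewrite size_OP.
have [kn'|nk] := ltnP k n; first by rewrite intW_OP_Xn// mulr0 mul0r.
have -> : nat_of_ord k = n by apply/eqP; rewrite eqn_leq kn nk.
by rewrite intW_OP_lead K0 mul0r.
Qed.

Lemma gamV n : (gam n)^-1 = norm n.
Proof. by rewrite invrK. Qed.

(** The value forced by the coefficient of $x^n$ in the recurrence. *)
Definition rec_alpha n : M := subcoef P n - subcoef P n.+1.

Definition rec_beta n : M := (gam n)^-1 * prevseq gam n.

(** The choice of [rec_alpha] lowers the degree of the remainder [Q] below [n]. Orthogonality makes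
    [Q] a left multiple of the previous polynomial, and one moment identifies the factor. *)
Lemma three_term n : P n * 'X =
  P n.+1 + (rec_alpha n)%:P * P n + (rec_beta n)%:P * prevseq P n.
Proof.
pose Q := P n * 'X - P n.+1 - (rec_alpha n)%:P * P n.
suff QE : Q = (rec_beta n)%:P * prevseq P n.
  by rewrite -QE /Q -[_ - _ - _]addrA -opprD subrKC.
have Q_ge k : (n <= k)%N -> Q`_k = 0.
  rewrite leq_eqVlt => /orP[/eqP <-|nk].
    rewrite /Q !coefB coefMX coefCM lead_OP mulr1 /rec_alpha.
    by case: (n) => [|m] /=; rewrite ?subrr// opprB addrCA subrr addr0 subrr.
  rewrite /Q !coefB coefMX coefCM [(P n)`_k]nth_default ?size_OP// mulr0 subr0.
  case: k nk => // k nk /=; rewrite ltnS leq_eqVlt in nk.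
  have [->|nk'] := predU1P nk; first by rewrite !lead_OP subrr.
  by rewrite !nth_default ?subr0// size_OP.
have QD : Q = P n * 'X - P n.+1 - (rec_alpha n)%:P * P n by [].
(* For [n = 0] the degree bound alone gives $Q=0$, matching the convention $P_{-1}=0$. *)
case: n Q QD Q_ge => [|m] Q QD Q_ge.
  by rewrite mulr0; apply/polyP => k; rewrite Q_ge// coef0.
set c := Q`_m; pose T := Q - c%:P * P m.
have T_ge k : (m <= k)%N -> T`_k = 0.
  rewrite leq_eqVlt => /orP[/eqP <-|mk].
    by rewrite coefB coefCM lead_OP mulr1 subrr.
  by rewrite coefB coefCM Q_ge// nth_default ?size_OP// mulr0 subr0.
(* The moments of $P_{m+2}$ and $P_{m+1}$ of order at most [m] vanish, so only the shifted term
   survives. *)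
have intQ k : (k <= m)%N -> intW (Q * 'X^k) = intW (P m.+1 * 'X^(k.+1)).
  move=> km; rewrite QD !mulrBl (intWD Wm) (intWN Wm) (intWD Wm) (intWN Wm).
  rewrite -[_%:P * _ * _]mulrA (intWMl Wm) (@intW_OP_Xn m.+2 k) ?ltnS ?(leqW km)//.
  by rewrite (@intW_OP_Xn m.+1 k)// mulr0 !subr0 -mulrA -exprS.
(* [T] has degree below [m] and its moments of order below [m] vanish, so it is orthogonal to
   itself. *)
have T0 : T = 0.
  apply: (mxinner_eq0 ab hW); rewrite (mxinner_intW Wm); apply: big1 => k _.
  have km : (k < m)%N.
    apply: (leq_trans (ltn_ord k)); apply/leq_sizeP => j; exact: T_ge.
  rewrite /T mulrBl (intWD Wm) (intWN Wm) intQ ?(ltnW km)// intW_OP_Xn//.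
  by rewrite -mulrA (intWMl Wm) intW_OP_Xn// mulr0 subrr mul0r.
have QE : Q = c%:P * P m by apply/eqP; rewrite -subr_eq0 -/T T0.
(* The moment of order [m] of [Q], computed in two ways. *)
have : c * norm m = norm m.+1.
  by rewrite -!intW_OP_lead -(intWMl Wm) mulrA -QE intQ.
move=> /(canRL (mulrK (norm_unit m))) cE.
by rewrite QE cE /rec_beta gamV.
Qed.

(** This is the inhomogeneous term of [stieltjes_three_term]. Its one nonzero case, [n = 0], is what
    the lower right identity block of $Y^0$ contributes. *)
Lemma intW_OP n : intW (P n) = if n is 0 then norm 0 else 0.
Proof.
case: n => [|n]; first by rewrite -intW_OP_lead expr0 mulr1.
by rewrite -[P _]mulr1 -(expr0 'X) intW_OP_Xn.
Qed.

Lemma mxeval_three_term n z : z *: mxeval (P n) z =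
  mxeval (P n.+1) z + rec_alpha n * mxeval (P n) z
    + rec_beta n * mxeval (prevseq P n) z.
Proof. by rewrite -mxevalMX three_term !mxevalD !mxevalMl. Qed.

Lemma stieltjes_three_term d n z : away a b d z ->
  z *: stieltjes a b W (P n) z + intW (P n) =
  stieltjes a b W (P n.+1) z + rec_alpha n * stieltjes a b W (P n) z
    + rec_beta n * stieltjes a b W (prevseq P n) z.
Proof.
move=> dz; rewrite -(stieltjesMX Wm _ dz) three_term.
by rewrite !(stieltjesD Wm _ _ dz) !(stieltjesMl Wm _ _ dz).
Qed.

Lemma two_pi_i_neq0 : two_pi_i R != 0.
Proof.
rewrite /two_pi_i eq_complex /= eqxx /=.
by rewrite mulf_neq0// ?pnatr_eq0// gt_eqF// pi_gt0.
Qed.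

Lemma RHY0 z : RHY a b W P 0 z =
  block_mx 1 ((two_pi_i R)^-1 *: stieltjes a b W (P 0) z) 0 1.
Proof.
have -> : (two_pi_i R)^-1 *: stieltjes a b W (P 0) z =
    cauchy_transform a b (weightC W) z; last by [].
have E : stieltjes a b W (P 0) z =
    mxint a b (fun t => (t%:C%C - z)^-1 *: weightC W t).
  by apply: eq_mxint => t _; rewrite /polyW OP0 mxeval1 mul1r.
by rewrite E.
Qed.

Lemma RHYS n z : RHY a b W P n.+1 z =
  block_mx (mxeval (P n.+1) z) ((two_pi_i R)^-1 *: stieltjes a b W (P n.+1) z)
    (- two_pi_i R *: (gam n * mxeval (P n) z)) (- (gam n * stieltjes a b W (P n) z)).
Proof.
have -> : - (gam n * stieltjes a b W (P n) z) = - two_pi_i R *: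
    (gam n * ((two_pi_i R)^-1 *: stieltjes a b W (P n) z)); last by [].
by rewrite -scalerAr scalerA mulNr mulfV ?two_pi_i_neq0// scaleN1r.
Qed.

(** The first block row is the recurrence, evaluated in one column and Stieltjes-transformed in the
    other; the second row only rescales the first row of $Y^n$. *)
Lemma transfer_rec_alpha : transfer_relation a b W P rec_alpha.
Proof.
move=> n z zoff; have [d dz] := off_cut_away ab zoff.
have ev := mxeval_three_term n z; have st := stieltjes_three_term n dz.
rewrite intW_OP in st.
have cancel (B : M) : - (two_pi_i R *: ((two_pi_i R)^-1 *: B)) = - B.
  by rewrite scalerA mulfV ?two_pi_i_neq0// scale1r.
have cancelV (B : M) : (two_pi_i R)^-1 *: (two_pi_i R *: B) = B.
  by rewrite scalerA mulVf ?two_pi_i_neq0// scale1r.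
have scal (A B : M) : (z%:M - A) *m B = z *: B - A * B.
  by rewrite mulmxBl mul_scalar_mx.
(* The case [n = 0] is separate because $Y^0$ has the second row $(0,I)$. *)
case: n ev st => [|n] ev st; rewrite /transfer ?RHY0 !RHYS mulmx_block !scal.
- rewrite !mul0mx !mulmx0 ?addr0 !mulmx1.
  rewrite [prevseq _ _]/= /rec_beta [prevseq _ _]/= mulr0 mul0r addr0 OP0 mxeval1 in ev.
  rewrite /rec_beta mulr0 mul0r addr0 in st.
  congr block_mx.
  + by rewrite ev addrK.
  + rewrite -scalerAr [z *: _]scalerA mulrC -scalerA -scalerBr -scalerDr gamV.
    by congr (_ *: _); rewrite addrAC st addrK.
  + by rewrite OP0 mxeval1 mulr1.
  + by rewrite mulmxE -scalerAl -scalerAr scaleNr cancel.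
- rewrite !mul0mx ?addr0; congr block_mx.
  + rewrite mulmxE -scalerAl -scalerAr scaleNr scalerN cancelV mulrA.
    by rewrite ev [X in _ = X - _]addrAC addrK /rec_beta addrK.
  + rewrite mulmxE -scalerAr [z *: _]scalerA mulrC -scalerA -scalerBr -scalerAl.
    rewrite -scalerDr mulrN mulrA; congr (_ *: _).
    by move: st; rewrite addr0 => ->; rewrite [X in _ = X - _]addrAC addrK addrK.
  + by rewrite mulmxE -scalerAl.
  + by rewrite mulmxE -scalerAl -scalerAr scaleNr cancel.
Qed.

Lemma off_cut_upper (y : R) : 0 < y -> off_cut a b (0 +i* y)%C.
Proof. by move=> y0 t _ [_ /eqP]; rewrite gt_eqF. Qed.

(** Comparing upper left blocks, the difference of the two coefficients times $P_n$ vanishes on the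
    upper imaginary axis, hence identically; $P_n$ is monic. *)
Lemma transfer_unique alpha :
  transfer_relation a b W P alpha -> rec_alpha = alpha.
Proof.
move=> h; apply/funext => n.
suff : (alpha n - rec_alpha n)%:P * P n = 0.
  move=> /(congr1 (fun q : {poly M} => q`_n)).
  by rewrite coefCM lead_OP mulr1 coef0 => /eqP; rewrite subr_eq0 => /eqP.
apply: mxeval_upper_eq0 => y /off_cut_upper yoff.
rewrite mxevalMl; set z := (0 +i* y)%C.
have := h n z yoff; rewrite (transfer_rec_alpha n yoff) -/z /transfer.
set V := (two_pi_i R)^-1 *: _; set U := - two_pi_i R *: _.
(* For [n = 0] the upper left block 1 is the value of [P 0], so both cases have this shape. *)
have [C [A [B ->]]] : exists C A B, RHY a b W P n z = block_mx (mxeval (P n) z) C A B.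
  case: (n) => [|m]; last by rewrite RHYS; do 3 eexists.
  by rewrite RHY0 OP0 mxeval1; do 3 eexists.
rewrite !mulmx_block => /eq_block_mx[/addIr + _ _ _].
move: (rec_alpha n) => r; rewrite !mulmxBl => /addrI /oppr_inj e.
by rewrite mulrBl -[r * _]/(r *m _) e subrr.
Qed.

End Orthogonality.

(** * Remainders of order $1/z^2$, and uniqueness of the expansion at infinity *)

Section Asymptotics.
Variables (R : realType) (N : nat) (a b : \bar R).
Local Notation D := (oitv a b).
Local Notation M := 'M[R[i]]_N.+1.
Local Notation normc := (@Normc.normc R).
Implicit Types (p q : {poly M}) (z : R[i]) (A : M) (F G : R[i] -> M).

Definition in_region (eps r : R) z := r <= normc z /\
  forall t, t \in citv a b -> eps * normc z <= normc (z - t%:C%C).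

(* F z = O(1/z^2) in the sense of RH_expansion. *)
Definition small F := forall eps : R, 0 < eps -> exists K r : R, 0 < r /\
  forall z, in_region eps r z -> forall i j, normc (F z i j) <= K / normc z ^+ 2.

Lemma in_regionW eps r s z : r <= s -> in_region eps s z -> in_region eps r z.
Proof. by move=> rs [sz hz]; split => //; exact: le_trans sz. Qed.

Lemma in_region_normc_gt0 eps r z : 0 < r -> in_region eps r z -> 0 < normc z.
Proof. by move=> r0 [rz _]; exact: lt_le_trans rz. Qed.

Lemma in_region_neq0 eps r z : 0 < r -> in_region eps r z -> z != 0.
Proof. by move=> r0 /(in_region_normc_gt0 r0); rewrite -normc_eq0 => /gt_eqF ->. Qed.

Lemma in_region_away eps r z : 0 < eps -> 0 < r -> in_region eps r z ->
  away a b (eps * normc z) z.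
Proof.
move=> eps0 r0 hz; split; first by rewrite mulr_gt0// (in_region_normc_gt0 r0 hz).
move=> t; rewrite inE => /andP[ax xb]; rewrite -opprB normcN.
by apply: hz.2; rewrite inE /citv /= !ltW.
Qed.

(** Since $|ir-t|\ge r$ for real $t$, the region with [eps = 1] contains points of arbitrarily large
    modulus whatever the cut. *)
Lemma in_region_imag (r : R) : 0 < r -> in_region 1 r (0 +i* r)%C.
Proof.
move=> r0; have nr : normc (0 +i* r)%C = r.
  by rewrite normc_sqrt /= expr0n add0r sqrtr_sqr gtr0_norm.
split; rewrite nr// => t _; rewrite mul1r -[leLHS](gtr0_norm r0).
by apply: (le_trans _ (normr_Im_le _)); rewrite /= subr0.
Qed.

(** Equality is asked only for nonzero [z] away from the cut, where one may divide by [z] and use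
    the Stieltjes identities. *)
Lemma eq_small F G :
  (forall d z, z != 0 -> away a b d z -> F z = G z) -> small F -> small G.
Proof.
move=> FG sF eps eps0; have [K [r [r0 h]]] := sF eps eps0.
exists K, r; split => // z hz i j.
by rewrite -(FG _ _ (in_region_neq0 r0 hz) (in_region_away eps0 r0 hz)) h.
Qed.

Lemma small0 : small (fun=> 0).
Proof.
by move=> eps _; exists 0, 1; split => // z _ i j; rewrite mxE Normc.normc0 mul0r.
Qed.

Lemma smallD F G : small F -> small G -> small (fun z => F z + G z).
Proof.
move=> sF sG eps eps0; have [K [r [r0 hF]]] := sF eps eps0.
have [L [s [s0 hG]]] := sG eps eps0.
exists (K + L), (Num.max r s); split; first by rewrite lt_max r0.
move=> z hz i j; rewrite mxE mulrDl; apply: (le_trans (@le_normcD _ _ _)).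
apply: lerD; [apply: hF|apply: hG]; apply: in_regionW hz; rewrite le_max lexx//.
by rewrite orbT.
Qed.

Lemma small_sum n (F : 'I_n -> R[i] -> M) :
  (forall k, small (F k)) -> small (fun z => \sum_(k < n) F k z).
Proof.
elim: n F => [|n ih] F sF.
  by apply: eq_small small0 => d z _ _; rewrite big_ord0.
apply: (@eq_small (fun z => F ord0 z + \sum_(k < n) F (lift ord0 k) z)).
  by move=> d z _ _; rewrite big_ord_recl.
by apply: smallD => //; exact: ih.
Qed.

Lemma smallMl A F : small F -> small (fun z => A * F z).
Proof.
move=> sF eps eps0; have [K [r [r0 hF]]] := sF eps eps0.
exists ((\sum_i \sum_k normc (A i k)) * K), r; split => // z hz i j.
rewrite -mulrA; have K0 : 0 <= K / normc z ^+ 2.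
  exact: le_trans (normc_ge0 _) (hF z hz 0 0).
rewrite mxE; apply: (le_trans (normc_le_sum _ _ _)).
apply: (@le_trans _ _ ((\sum_k normc (A i k)) * (K / normc z ^+ 2))).
  rewrite mulr_suml; apply: ler_sum => k _; rewrite Normc.normcM.
  by rewrite ler_wpM2l ?normc_ge0// hF.
apply: ler_wpM2r => //; rewrite [leRHS](bigD1 i)//= lerDl sumr_ge0// => k _.
by apply: sumr_ge0 => l _; exact: normc_ge0.
Qed.

Lemma smallZ c F : small F -> small (fun z => c *: F z).
Proof.
move=> /(smallMl c%:M); apply: eq_small => d z _ _.
by rewrite -mulmxE mul_scalar_mx.
Qed.

(** The threshold 1 ensures $|z|\ge1$, so higher negative powers are dominated by $|z|^{-2}$. *)
Lemma small_inv_exp m A : small (fun z => z ^- m.+2 *: A).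
Proof.
move=> eps eps0; exists (\sum_i \sum_j normc (A i j)), 1; split => // z hz i j.
have z0 : 0 < normc z by exact: in_region_normc_gt0 hz.
rewrite mxE Normc.normcM Normc.normcV normcX mulrC; apply: ler_pM.
- exact: normc_ge0.
- by rewrite invr_ge0 exprn_ge0// ltW.
- rewrite (bigD1 i)//= (bigD1 j)//= -addrA lerDl addr_ge0 ?sumr_ge0//.
    by move=> k _; exact: normc_ge0.
  by move=> k _; apply: sumr_ge0 => l _; exact: normc_ge0.
- rewrite lef_pV2 ?posrE ?exprn_gt0//; apply: ler_weXn2l => //.
  by case: hz.
Qed.

(** The strict bound on the size means degree at most $n-2$, so every power of [z] that occurs is at
    most $-2$. *)
Lemma small_mxeval p n : (size p < n)%N -> small (fun z => z ^- n *: mxeval p z).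
Proof.
move=> pn; apply: (@eq_small (fun z => \sum_(k < size p) z ^- (n - k) *: p`_k)).
  move=> _ z z0 _; rewrite mxeval_coef scaler_sumr; apply: eq_bigr => k _.
  rewrite scalerA; congr (_ *: _).
  have kn : (k <= n)%N by rewrite (leq_trans (ltnW (ltn_ord k)))// ltnW.
  by rewrite -[in RHS](subnK kn) exprD invfM mulfVK ?expf_neq0.
apply: small_sum => k; have kn : (k.+2 <= n)%N by exact: leq_ltn_trans (ltn_ord k) pn.
by rewrite -(subnKC kn) addSn addSn -addnS -addnS addKn; exact: small_inv_exp.
Qed.

Variable W : R -> 'M[R]_N.+1.
Hypothesis W_moments : forall i j, finite_moments D (fun x => W x i j).

(** In the region the distance to the cut is at least [eps] times $|z|$, so [stieltjes_bound]
    supplies the second factor $1/|z|$. *)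
Lemma small_stieltjes p : small (fun z => z^-1 *: stieltjes a b W p z).
Proof.
move=> eps eps0; have [K K0 hK] := stieltjes_bound W_moments p.
exists (K / eps), 1; split => // z hz i j.
have z0 : 0 < normc z by exact: in_region_normc_gt0 hz.
have h := hK _ _ (in_region_away eps0 ltr01 hz) i j.
rewrite mxE Normc.normcM Normc.normcV.
rewrite expr2 invfM mulrC [leRHS]mulrA; apply: ler_wpM2r.
  by rewrite invr_ge0 ltW.
by rewrite -mulrA -invfM.
Qed.

Variable P : nat -> {poly M}.

(** Undoing the diagonal factor multiplies the first block column by $z^{-n}$ and the second by
    $z^n$; the four block estimates then share the maximum of their constants and thresholds. *)
Lemma RH_expansion_block n (A B C E : R[i] -> M) (y11 y12 y21 y22 : M) :
  (forall z, RHY a b W P n z = block_mx (A z) (B z) (C z) (E z)) ->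
  small (fun z => z ^- n *: A z - 1 - z^-1 *: y11) ->
  small (fun z => z ^+ n *: B z - z^-1 *: y12) ->
  small (fun z => z ^- n *: C z - z^-1 *: y21) ->
  small (fun z => z ^+ n *: E z - 1 - z^-1 *: y22) ->
  RH_expansion a b W P n (block_mx y11 y12 y21 y22).
Proof.
move=> hY sA sB sC sE eps eps0.
have [KA [rA [rA0 hA]]] := sA eps eps0; have [KB [rB [rB0 hB]]] := sB eps eps0.
have [KC [rC [rC0 hC]]] := sC eps eps0; have [KE [rE [rE0 hE]]] := sE eps eps0.
pose r := Num.max (Num.max rA rB) (Num.max rC rE).
pose K := Num.max (Num.max KA KB) (Num.max KC KE).
have r0 : 0 < r by rewrite !lt_max rA0.
exists K, r; split => // z rz hz.
have reg : in_region eps r z by [].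
have z0 := in_region_neq0 r0 reg.
pose EE := block_mx (z ^- n *: A z - 1 - z^-1 *: y11) (z ^+ n *: B z - z^-1 *: y12)
  (z ^- n *: C z - z^-1 *: y21) (z ^+ n *: E z - 1 - z^-1 *: y22).
exists EE; split.
  rewrite hY /EE (scalar_mx_block _ _ 1) scale_block_mx !add_block_mx mulmx_block.
  have add1 (X Y : M) : 1%:M + Y + (X - 1 - Y) = X.
    by rewrite -[X - 1 - Y]addrA -opprD subrKC.
  rewrite !add0r !add1 !subrKC !mulmx0 ?addr0 ?add0r !mul_mx_scalar !scalerA.
  by rewrite !mulfV ?mulVf ?expf_neq0// !scale1r.
have le (L : R) (X : R) : X <= L / normc z ^+ 2 -> L <= K -> X <= K / normc z ^+ 2.
  move=> XL LK; apply: (le_trans XL); rewrite ler_wpM2r// invr_ge0.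
  by rewrite exprn_ge0// normc_ge0.
move=> i j; case: (split_ordP i) => k ->; case: (split_ordP j) => l ->.
- rewrite block_mxEul; apply: (le KA); last by rewrite !le_max lexx.
  by apply: hA; apply: in_regionW reg; rewrite !le_max lexx.
- rewrite block_mxEur; apply: (le KB); last by rewrite !le_max lexx ?orbT.
  by apply: hB; apply: in_regionW reg; rewrite !le_max lexx ?orbT.
- rewrite block_mxEdl; apply: (le KC); last by rewrite !le_max lexx ?orbT.
  by apply: hC; apply: in_regionW reg; rewrite !le_max lexx ?orbT.
- rewrite block_mxEdr; apply: (le KE); last by rewrite !le_max lexx ?orbT.
  by apply: hE; apply: in_regionW reg; rewrite !le_max lexx ?orbT.
Qed.

(** On the imaginary axis $z^{-1}(Y-Z)$ is a difference of two remainders, hence $O(1/y^2)$; a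
    nonzero entry of $Y-Z$ would violate this for large $y$. *)
Lemma RH_expansion_unique n (Y Z : 'M[R[i]]_(N.+1 + N.+1)) :
  RH_expansion a b W P n Y -> RH_expansion a b W P n Z -> Y = Z.
Proof.
move=> hY hZ; have [K [r [r0 hK]]] := hY 1 ltr01; have [L [s [s0 hL]]] := hZ 1 ltr01.
apply/matrixP => i j; apply/eqP; rewrite -subr_eq0 -normc_eq0; apply/negP => /negP d0.
set d := normc _ in d0; have {d0} : 0 < d by rewrite lt_def d0 normc_ge0.
(* The last term forces $dy>K+L$, against the bound derived below; the absolute value is there
   because [K] and [L] have no known sign. *)
move=> d0; pose y := Num.max (Num.max r s) ((`|K + L| + 1) / d).
have y0 : 0 < y by rewrite !lt_max r0.
have [ry sy dy] : [/\ r <= y, s <= y & (`|K + L| + 1) / d <= y].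
  by rewrite !le_max !lexx ?orbT.
have hy := in_region_imag y0; set z := (0 +i* y)%C in hy.
have z0 := in_region_neq0 y0 hy.
have nz : normc z = y by rewrite normc_sqrt /= expr0n add0r sqrtr_sqr gtr0_norm.
have [ry1 ry2] := in_regionW ry hy; have [sy1 _] := in_regionW sy hy.
have [E [eE bE]] := hK z ry1 ry2; have [F [eF bF]] := hL z sy1 ry2.
set B := block_mx _ _ _ _ in eE; rewrite eE in eF.
pose B' : 'M[R[i]]_(N.+1 + N.+1) := block_mx (z ^- n)%:M 0 0 (z ^+ n)%:M.
have BB' : B *m B' = 1%:M.
  rewrite mulmx_block !mulmx0 !mul0mx ?addr0 ?add0r -!scalar_mxM.
  by rewrite mulfV ?mulVf ?expf_neq0// -scalar_mx_block.
have := congr1 (fun X => X *m B') eF.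
rewrite -!mulmxA BB' !mulmx1 -!addrA => /addrI eq.
have {}eq : z^-1 *: (Y - Z) = F - E.
  by rewrite scalerBr; apply/eqP; rewrite subr_eq addrAC eq_sym subr_eq addrC -eq addrC.
have := congr1 (fun X : 'M[R[i]]_(N.+1 + N.+1) => normc (X i j)) eq.
rewrite !mxE Normc.normcM Normc.normcV nz -/d => eqd.
have : y^-1 * d <= (K + L) / y ^+ 2.
  rewrite eqd; apply: (le_trans (@le_normcD _ _ _)); rewrite normcN addrC mulrDl.
  by rewrite -nz lerD.
rewrite expr2 invfM [leRHS]mulrC -mulrA ler_pM2l ?invr_gt0// mulrC ler_pdivlMr//.
rewrite leNgt => /negP; apply.
move: dy; rewrite ler_pdivrMr// mulrC => dy; apply: lt_le_trans dy.
by rewrite (le_lt_trans (ler_norm _))// ltrDl.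
Qed.

End Asymptotics.

(** * The explicit coefficient of $1/z$ in the expansion of $Y^n$ *)

Section Expansion.
Variables (R : realType) (N : nat) (a b : \bar R) (W : R -> 'M[R]_N.+1).
Hypothesis ab : (a < b)%E.
Hypothesis hW : is_weight a b W.
Variable P : nat -> {poly 'M[R[i]]_N.+1}.
Hypothesis hP : forall n, is_monic_OP a b W n (P n).
Local Notation M := 'M[R[i]]_N.+1.
Local Notation gam := (gam a b W P).
Local Notation norm n := (mxinner a b W (P n) (P n)).
Local Notation S := (stieltjes a b W).

Let Wm := weight_moments hW.

Lemma stieltjes_OP_MXn n d z : away a b d z ->
  S (P n * 'X^(n.+1)) z = z ^+ n.+1 *: S (P n) z + norm n.
Proof.
move=> dz; rewrite (stieltjesMXn Wm _ _ dz); congr (_ + _).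
rewrite big_ord_recr /= big1 => [|k _]; last first.
  by rewrite (intW_OP_Xn hW hP)// scaler0.
by rewrite add0r subnn expr0 scale1r (intW_OP_lead hW hP).
Qed.

(** One order further than [stieltjes_OP_MXn], for the lower right block: there the norm produces
    the identity, and the $1/z$ term comes from the next moment. *)
Lemma stieltjes_OP_MXn2 n d z : away a b d z ->
  S (P n * 'X^(n.+2)) z = z ^+ n.+2 *: S (P n) z + z *: norm n
    + intW a b W (P n * 'X^(n.+1)).
Proof.
move=> dz; rewrite exprSr mulrA (stieltjesMX Wm _ dz) (stieltjes_OP_MXn n dz).
by rewrite scalerDr scalerA -exprS.
Qed.

Definition RHY1_block n := block_mx (subcoef P n)
  (- (two_pi_i R)^-1 *: norm n) (- two_pi_i R *: prevseq gam n)
  (if n is m.+1 then gam m * intW a b W (P m * 'X^(m.+1)) else 0).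

Lemma size_OP_sub n : (size (P n - 'X^n)%R <= n)%N.
Proof.
apply/leq_sizeP => k; rewrite leq_eqVlt => /orP[/eqP <-|nk].
  by rewrite coefB coefXn eqxx (lead_OP hP) subrr.
by rewrite coefB coefXn gtn_eqF//= subr0 nth_default// (size_OP hP).
Qed.

Lemma mxevalXn n z : mxeval ('X^n : {poly M}) z = (z ^+ n)%:M.
Proof. by rewrite -['X^n]mul1r mxevalMXn mxeval1 -[RHS]scalemx1. Qed.

(** Removing the two leading terms of $P_n$ leaves degree at most $n-2$. *)
Lemma small_OP11 n : small a b
  (fun z => z ^- n *: mxeval (P n) z - 1 - z^-1 *: subcoef P n).
Proof.
case: n => [|m].
  apply: eq_small (@small0 _ _ _ _) => _ z z0 _.
  by rewrite (OP0 hP) mxeval1 expr0 invr1 scale1r subrr scaler0 subrr.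
pose p := P m.+1 - 'X^(m.+1) - (subcoef P m.+1)%:P * 'X^m.
have sp : (size p < m.+1)%N.
  rewrite ltnS; apply/leq_sizeP => k; rewrite leq_eqVlt => /orP[/eqP <-|mk].
    by rewrite !coefB coefCM !coefXn eqxx ltn_eqF// mulr1 subr0 subrr.
  rewrite coefB nth_default ?(leq_trans (size_OP_sub _))// coefCM coefXn.
  by rewrite gtn_eqF// mulr0 subr0.
apply: eq_small (small_mxeval a b sp) => _ z z0 _.
rewrite !mxevalD !mxevalN mxevalMl !mxevalXn !scalerBr.
congr (_ - _ - _).
  by rewrite -scalemx1 scalerA mulVf ?scale1r ?expf_neq0.
rewrite -mulmxE mul_mx_scalar scalerA; congr (_ *: _).
by rewrite exprS invfM mulfVK ?expf_neq0.
Qed.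

Lemma small_OP21 m : small a b
  (fun z => z ^- m.+1 *: (- two_pi_i R *: (gam m * mxeval (P m) z))
    - z^-1 *: (- two_pi_i R *: gam m)).
Proof.
apply: eq_small (smallZ (- two_pi_i R) (smallMl (gam m)
  (@small_mxeval _ _ a b _ m.+1 (size_OP_sub m)))) => _ z z0 _.
rewrite mxevalD mxevalN mxevalXn scalerBr mulrBr scalerBr; congr (_ - _).
  by rewrite -scalerAr !scalerA mulrC.
rewrite -scalemx1 scalerA exprS invfM mulfVK ?expf_neq0// -scalerAr.
by rewrite -[_ * 1%:M]/(_ *m _) mulmx1 !scalerA mulrC.
Qed.

Lemma small_OP12 n : small a b
  (fun z => z ^+ n *: ((two_pi_i R)^-1 *: S (P n) z)
    - z^-1 *: (- (two_pi_i R)^-1 *: norm n)).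
Proof.
apply: eq_small (smallZ (two_pi_i R)^-1 (small_stieltjes Wm (P n * 'X^(n.+1))))
  => d z z0 dz.
rewrite (stieltjes_OP_MXn n dz) !scalerDr !scalerA; congr (_ + _).
  by congr (_ *: _); rewrite exprS -mulrA mulKf// mulrC.
by rewrite -scaleNr mulrN opprK mulrC.
Qed.

(** The subtracted identity is $\gamma_m$ times the norm of $P_m$, which needs the norm to be
    invertible. *)
Lemma small_OP22 m : small a b
  (fun z => z ^+ m.+1 *: - (gam m * S (P m) z) - 1
    - z^-1 *: (gam m * intW a b W (P m * 'X^(m.+1)))).
Proof.
apply: eq_small (smallMl (- gam m) (small_stieltjes Wm (P m * 'X^(m.+2))))
  => d z z0 dz.
rewrite (stieltjes_OP_MXn2 m dz).
have gu : gam m * norm m = 1 by rewrite mulVr// (norm_unit ab hW hP).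
move: (S (P m) z) (norm m) (intW a b W _) (gam m) gu => s G w g gu.
rewrite !scalerDr !mulrDr !scalerA !mulNr; congr (_ - _ - _).
- by rewrite exprS mulKf// -scalerAr scalerN.
- by rewrite mulVf// scale1r gu.
- by rewrite -scalerAr.
Qed.

Lemma RH_expansion_OP n : RH_expansion a b W P n (RHY1_block n).
Proof.
case: n => [|m]; (apply: RH_expansion_block; [by move=> z; first
  [exact: RHY0 hP z|exact: RHYS]|..]).
- have := small_OP11 0; apply: eq_small => _ z _ _.
  by rewrite (OP0 hP) mxeval1.
- exact: small_OP12.
- by apply: eq_small (@small0 _ _ _ _) => _ z _ _; rewrite !scaler0 subrr.
- apply: eq_small (@small0 _ _ _ _) => _ z _ _.
  by rewrite expr0 scale1r subrr scaler0 subrr.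
- exact: small_OP11.
- exact: small_OP12.
- exact: small_OP21.
- exact: small_OP22.
Qed.

(** Existence and uniqueness of the expansion determine the matrix picked by [xget]. *)
Lemma RHY1_OP n : RHY1 a b W P n = RHY1_block n.
Proof.
apply: xget_unique; first exact: RH_expansion_OP.
by move=> Y hY; apply: RH_expansion_unique hY (RH_expansion_OP n).
Qed.

End Expansion.

Theorem theorem2p16 (R : realType) (N : nat) (a b : \bar R) (hab : (a < b)%E)
    (W : R -> 'M[R]_N.+1) (hW : is_weight a b W)
    (P : nat -> {poly 'M[R[i]]_N.+1})
    (hP : forall n, is_monic_OP a b W n (P n)) :
  exists alpha beta : nat -> 'M[R[i]]_N.+1,
    [/\ unique (transfer_relation a b W P) alpha,
        forall n, 'X * P n
          = P n.+1 + (alpha n)%:P * P n + (beta n)%:P * prevseq P n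
      & forall n,
        RH_expansion a b W P n (RHY1 a b W P n)
        /\ (alpha n = Y1_11 a b W P n - Y1_11 a b W P n.+1
            /\ alpha n = subcoef P n - subcoef P n.+1)
        /\ (beta n = Y1_12 a b W P n * Y1_21 a b W P n
            /\ beta n = (gam a b W P n)^-1 * prevseq (gam a b W P) n)
        /\ (gam a b W P n = - (two_pi_i R)^-1 *: Y1_21 a b W P n.+1
            /\ Y1_12 a b W P n \is a GRing.unit
            /\ gam a b W P n = - (two_pi_i R)^-1 *: (Y1_12 a b W P n)^-1)].
Proof.
have tpi0 := two_pi_i_neq0 R.
have tpiN0 : - (two_pi_i R)^-1 != 0 by rewrite oppr_eq0 invr_eq0.
exists (rec_alpha P), (rec_beta a b W P); split.
- split; first exact: transfer_rec_alpha.
  by move=> alpha; exact: transfer_unique.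
(* The variable is central, so the side on which it multiplies is immaterial. *)
- by move=> n; rewrite -commr_polyX; exact: three_term.
move=> n; have nu := norm_unit hab hW hP n.
(* With $Y_1^n$ explicit, the coefficient formulas reduce to reading off blocks and cancelling
   factors $2\pi i$. *)
rewrite /Y1_11 /Y1_12 /Y1_21 !(RHY1_OP hab hW hP) /RHY1_block.
rewrite !block_mxKul !block_mxKur !block_mxKdl; do 3?split => //.
- exact: RH_expansion_OP.
- split => //; rewrite -scalerAl -scalerAr scalerA mulrNN mulVf// scale1r.
  by rewrite /rec_beta gamV.
- split; last split.
  + by rewrite scalerA mulrNN mulVf// scale1r.
  + by rewrite scaler_unit// unitfE.
  + by rewrite invrZ ?unitfE// scalerA mulfV// scale1r.
Qed.
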